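(* Let $n \ge 4$ be an integer with $n \ne 6$, and let $\rho$ be an integer with $1 \le \rho \le n$. Then there exists a $(3n+1+\rho,4)$-packing with exactly $n\rho + D(\rho+1,4)$ blocks in which the largest partial parallel class has size $\rho$.
   Context: For integers $v \ge k \ge 2$, a $(v,k)$-packing is a pair $(X,\mathcal{B})$ where $X$ is a set of $v$ points and $\mathcal{B}$ is a set of $k$-subsets of $X$ (blocks) such that every pair of distinct points lies in at most one block. For integers $m \ge 0$, $D(m,k)$ denotes the maximum number of $k$-subsets of an $m$-set such that every pair of points lies in at most one of them (so $D(m,k)=0$ if $m<k$). A partial parallel class (PPC) is a set of pairwise disjoint blocks; its size is the number of blocks. ''The largest PPC has size $\rho$'' means the packing has a PPC of size $\rho$ but none of size $\rho+1$. *)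

(* Defs.v *)
From mathcomp Require Import all_boot.
Set Implicit Arguments. Unset Strict Implicit. Unset Printing Implicit Defensive.

(* A (v,k)-packing on the point set 'I_v: a set B of k-subsets (blocks) such
   that every pair of distinct points lies in at most one block, i.e. two
   distinct blocks share at most one point. *)
Definition is_packing (v k : nat) (B : {set {set 'I_v}}) : bool :=
  [forall b in B, #|b| == k] &&
  [forall b1 in B, forall b2 in B, (b1 != b2) ==> (#|b1 :&: b2| <= 1)].

(* D(m,k): maximum number of blocks of an (m,k)-packing (0 if m < k). *)
Definition D (m k : nat) : nat :=
  \max_(B : {set {set 'I_m}} | is_packing k B) #|B|.

Definition is_ppc (v : nat) (B P : {set {set 'I_v}}) : bool :=
  (P \subset B) &&
  [forall b1 in P, forall b2 in P, (b1 != b2) ==> [disjoint b1 & b2]].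

Definition largest_ppc_size (v : nat) (B : {set {set 'I_v}}) (rho : nat) : Prop :=
  (exists P, is_ppc B P /\ #|P| = rho) /\
  (forall P, is_ppc B P -> #|P| <= rho).

(* Main.v *)
Require Import Defs.
From mathcomp Require Import all_boot all_algebra finfield zify.
Set Implicit Arguments. Unset Strict Implicit. Unset Printing Implicit Defensive.
Import GRing.Theory.

(* Take the 3n points X = Z_3 x G with |G| = n, rho further points labelled by
   elements of G, and one point oo.  Suppose X carries n parallel classes of
   triples, one for each g in G, such that two points of X lie together in at
   most one triple.  Adding the label g to the triples of the class of g gives
   n * rho blocks, and an optimal packing on the labels and oo contributes
   D (rho + 1) 4 more.  Every block contains a label, so a PPC has at most rho
   blocks; pairwise disjoint triples, one from each class, give a PPC of size
   rho.

   The parallel classes are the translates under G of one base class, which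
   consists of triples {(i, x), (i, y), (i + 1, z)} for i in Z_3 and (x, y, z)
   in a list P, and of triples {(0, u), (1, v), (2, w)} for (u, v, w) in a list
   Q.  They must be disjoint, and all differences within a G-orbit of X, as well
   as all those from one orbit to the next, must be distinct.  The translates of
   one triple of the second kind are pairwise disjoint.  If a, a - 1 and a + 1
   are units of a ring, then P = [] and Q = {(x, a x, a^2 x)} will do: a = 2
   settles the n coprime to 6, and GF(8) settles n = 8.  The other n use explicit
   families over Z_n, made of two arithmetic progressions of triples in P and a
   bounded number of further triples. *)

Definition packing_exists (n rho : nat) : Prop :=
  exists B : {set {set 'I_(3 * n + 1 + rho)}},
    is_packing 4 B /\ #|B| = n * rho + D rho.+1 4 /\ largest_ppc_size B rho.

(** * Packings from labelled parallel classes *)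

Lemma D_attained m k : exists2 B : {set {set 'I_m}}, is_packing k B & #|B| = D m k.
Proof.
have pack0 : is_packing k (set0 : {set {set 'I_m}}).
  by apply/andP; split; apply/forallP => b; rewrite in_set0.
have /eq_bigmax_cond : (0 < #|[pred B : {set {set 'I_m}} | is_packing k B]|)%N.
  by apply/card_gt0P; exists set0.
by move=> /(_ (fun B => #|B|)) [B packB eB]; exists B.
Qed.

Section LabelledParallelClasses.
Variables (X L : finType) (n rho : nat).
(** [F y] is the parallel class with label [y], and [R y] the triple chosen in it for the PPC of
    size [rho]. *)
Variables (F : L -> {set {set X}}) (R : L -> {set X}).
Hypotheses (cardX : #|X| = 3 * n) (cardL : #|L| = n) (rho_gt0 : 0 < rho) (rho_n : rho <= n).
Hypotheses (F_card : forall y, #|F y| = n).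
Hypotheses (F_card3 : forall y B, B \in F y -> #|B| = 3).
Hypotheses (F_point : forall y B B' p, B \in F y -> B' \in F y -> p \in B -> p \in B' -> B = B').
Hypotheses (F_pair : forall y y' B B' p q, B \in F y -> B' \in F y' -> p != q ->
  p \in B -> q \in B -> p \in B' -> q \in B' -> y = y').
Hypotheses (R_mem : forall y, R y \in F y).
Hypotheses (R_disj : forall y y', y != y' -> [disjoint R y & R y']).

Let size_eq : 3 * n + rho.+1 = 3 * n + 1 + rho. Proof. by rewrite addn1 addSnnS. Qed.
Let e1 (x : X) : 'I_(3 * n + 1 + rho) :=
  cast_ord size_eq (lshift rho.+1 (cast_ord cardX (enum_rank x))).
(** [e2 ord0] is the point oo, and [e2 (lift ord0 i)] is the point of the label [lab i]; the labels
    are the first [rho] elements of [L]. *)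
Let e2 (i : 'I_rho.+1) : 'I_(3 * n + 1 + rho) := cast_ord size_eq (rshift (3 * n) i).
Let lab (i : 'I_rho) : L := enum_val (cast_ord (esym cardL) (widen_ord rho_n i)).

Let e1_inj : injective e1.
Proof. by move=> x y /cast_ord_inj/lshift_inj/cast_ord_inj/enum_rank_inj. Qed.

Let e2_inj : injective e2.
Proof. by move=> x y /cast_ord_inj/rshift_inj. Qed.

Let e1_e2 x i : (e1 x == e2 i) = false.
Proof. by rewrite (inj_eq (@cast_ord_inj _ _ _)) eq_lrshift. Qed.

Let lab_inj : injective lab.
Proof. by move=> i j /enum_val_inj/cast_ord_inj/(congr1 val) /= /val_inj. Qed.

Let star (i : 'I_rho) (B : {set X}) := e2 (lift ord0 i) |: (e1 @: B).

Let mem_star_e1 i B x : (e1 x \in star i B) = (x \in B).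
Proof. by rewrite in_setU1 e1_e2 mem_imset. Qed.

Let e2_imset_e1 j (B : {set X}) : (e2 j \in e1 @: B) = false.
Proof. by apply/imsetP => -[x _ /eqP]; rewrite eq_sym e1_e2. Qed.

Let mem_star_e2 i B j : (e2 j \in star i B) = (j == lift ord0 i).
Proof. by rewrite in_setU1 e2_imset_e1 orbF (inj_eq e2_inj). Qed.

Let starP i B p : p \in star i B -> p = e2 (lift ord0 i) \/ exists2 x, x \in B & p = e1 x.
Proof. by case/setU1P => [|/imsetP]; [left|right]. Qed.

Let stars := [set star p.1 p.2 | p in [set p : 'I_rho * {set X} | p.2 \in F (lab p.1)]].

Let starsP b : b \in stars -> exists i, exists2 B, B \in F (lab i) & b = star i B.
Proof. by case/imsetP => -[i B]; rewrite inE /= => BF ->; exists i, B. Qed.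

Let F_nonempty y B : B \in F y -> exists x, x \in B.
Proof. by move=> /F_card3 h; apply/card_gt0P; rewrite h. Qed.

Let card_stars : #|stars| = n * rho.
Proof.
rewrite card_in_imset.
  rewrite -sum1_card (eq_bigl (fun p : 'I_rho * {set X} => true && (p.2 \in F (lab p.1)))).
    rewrite -(pair_big_dep predT (fun i B => B \in F (lab i)) (fun _ _ => 1)) /=.
    under eq_bigr => i _ do rewrite sum1_card F_card.
    by rewrite sum_nat_const card_ord mulnC.
  by move=> p; rewrite inE.
move=> [i B] [j C] _ _ /= e.
have ij : i = j.
  by apply/(@lift_inj _ ord0)/eqP; rewrite -(mem_star_e2 j C) -e mem_star_e2 eqxx.
by congr pair => //; apply/setP => x; rewrite -(mem_star_e1 i) e mem_star_e1.
Qed.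

Lemma packing_of_parallel_classes : packing_exists n rho.
Proof.
have [B0 packB0 cardB0] := D_attained rho.+1 4.
have [/forall_inP B0_4 /forall_inP B0_pair] := andP packB0.
pose emb (b : {set 'I_rho.+1}) := e2 @: b.
have emb_inj : injective emb by apply: imset_inj.
have star_emb i C b : C \in F (lab i) -> star i C != emb b.
  move=> CF; have [x xC] := F_nonempty CF; apply/eqP => e.
  have : e1 x \in emb b by rewrite -e mem_star_e1.
  by case/imsetP => j _ /eqP; rewrite e1_e2.
have star_card i C : C \in F (lab i) -> #|star i C| = 4.
  by move=> CF; rewrite cardsU1 e2_imset_e1 card_imset // (F_card3 CF).
(* One of the two points lies in [X]. If the other is a label, the stars share it; if not, [F_pair]
   makes the labels equal. The point of [X] then fixes the triple. *)
have star_pair i j C C' p q : C \in F (lab i) -> C' \in F (lab j) -> p != q ->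
    p \in star i C -> p \in star j C' -> q \in star i C -> q \in star j C' ->
    star i C = star j C'.
  move=> CF CF' npq pC pC' qC qC'.
  have same x : i = j -> x \in C -> x \in C' -> star i C = star j C'.
    by move=> eij xC xC'; subst j; rewrite (F_point CF CF' xC xC').
  have [ep|[x xC ep]] := starP pC; have [eq|[y yC eq]] := starP qC; subst p q.
  - by rewrite eqxx in npq.
  - move: pC' qC'; rewrite mem_star_e2 mem_star_e1 => /eqP/lift_inj ij yC'.
    exact: same ij yC yC'.
  - move: pC' qC'; rewrite mem_star_e2 mem_star_e1 => xC' /eqP/lift_inj ij.
    exact: same ij xC xC'.
  - move: pC' qC'; rewrite !mem_star_e1 => xC' yC'.
    have nxy : x != y by apply: contraNneq npq => ->.
    by apply: (same x) => //; apply/lab_inj/(F_pair CF CF' nxy).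
(* The label is the only point of a star outside [X]. *)
have star_emb_pair i C b p q : p \in star i C -> p \in emb b ->
    q \in star i C -> q \in emb b -> p = q.
  move=> pC /imsetP[j _ ep] qC /imsetP[l _ eq]; move: pC qC; rewrite ep eq !mem_star_e2.
  by move=> /eqP-> /eqP->.
exists (stars :|: emb @: B0); split; last split.
- apply/andP; split.
    apply/forall_inP => b /setUP[/starsP[i [C CF ->]]|/imsetP[b0 b0B ->]].
      by rewrite star_card.
    by rewrite card_imset // B0_4.
  apply/forall_inP => b hb; apply/forall_inP => b' hb'; apply/implyP => nbb'.
  move: hb hb' nbb' => /setUP[/starsP[i [C CF ->]]|/imsetP[c cB ->]]
      /setUP[/starsP[j [C' CF' ->]]|/imsetP[c' cB' ->]] nbb'.
  + apply/card_le1_eqP => p q /setIP[pC pC'] /setIP[qC qC'].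
    apply/eqP/negPn/negP => npq; case/eqP: nbb'.
    by apply: (star_pair _ _ _ _ q p) => //; rewrite eq_sym.
  + by apply/card_le1_eqP => p q /setIP[pC pC'] /setIP[qC qC']; exact: star_emb_pair qC qC' pC pC'.
  + by apply/card_le1_eqP => p q /setIP[pC pC'] /setIP[qC qC']; exact: star_emb_pair qC' qC pC' pC.
  + rewrite -imsetI; last by move=> x y _ _; apply: e2_inj.
    rewrite card_imset //; have /forall_inP/(_ c' cB')/implyP := B0_pair c cB; apply.
    by apply: contraNneq nbb' => ->.
- rewrite cardsU (_ : stars :&: _ = set0) ?cards0 ?subn0.
    by rewrite card_stars card_imset // cardB0.
  apply/setP => b; rewrite in_set0; apply/setIP => -[/starsP[i [C CF ->]] /imsetP[c _ /eqP]].
  by rewrite (negPf (star_emb _ _ _ CF)).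
split.
  exists [set star i (R (lab i)) | i : 'I_rho]; split; last first.
    rewrite card_imset ?card_ord // => i j e; apply/(@lift_inj _ ord0)/eqP.
    by rewrite -(mem_star_e2 j (R (lab j))) -e mem_star_e2 eqxx.
  apply/andP; split.
    apply/subsetP => _ /imsetP[i _ ->]; apply/setUP; left; apply/imsetP.
    by exists (i, R (lab i)); rewrite ?inE ?R_mem.
  apply/forall_inP => _ /imsetP[i _ ->]; apply/forall_inP => _ /imsetP[j _ ->].
  apply/implyP => ne; have nij : i != j by apply: contraNneq ne => ->.
  apply/pred0P => p; apply/negP => /andP[] /starP[->|[x xR ->]].
    by rewrite /= mem_star_e2 (inj_eq (@lift_inj _ _)) (negPf nij).
  rewrite /= mem_star_e1 => xR'.
  have := R_disj (_ : lab i != lab j); rewrite (inj_eq lab_inj) => /(_ nij)/pred0P/(_ x).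
  by rewrite /= xR xR'.
move=> S /andP[/subsetP SB /forall_inP Sdisj].
(* [hit] picks a label in each block; on blocks of [S] the default value is never reached, by
   [hitP]. Disjoint blocks get different labels, so [S] has at most [rho] blocks. *)
pose hit (b : {set 'I_(3 * n + 1 + rho)}) := odflt (Ordinal rho_gt0) [pick i | e2 (lift ord0 i) \in b].
have hitP b : b \in S -> e2 (lift ord0 (hit b)) \in b.
  move=> bS; rewrite /hit; case: pickP => //= none; exfalso.
  have /setUP[/starsP[i [C CF eb]]|/imsetP[c cB eb]] := SB b bS.
    by have := none i; rewrite eb mem_star_e2 eqxx.
  (* A block of the extra packing has 4 points, so a label remains when oo is removed. *)
  have : 0 < #|c :\ ord0|.
    by have := cardsD1 ord0 c; rewrite (eqP (B0_4 c cB)); case: #|_ :\ _| => //; case: (_ \in _).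
  case/card_gt0P => j; rewrite !inE => /andP[j0 jc].
  case: (unliftP ord0 j) => [i ej|ej]; last by rewrite ej eqxx in j0.
  by have := none i; rewrite eb -ej mem_imset // jc.
rewrite -[rho in _ <= rho]card_ord -(@card_in_imset _ _ hit).
  exact: max_card.
move=> b b' bS bS' e; apply/eqP/negPn/negP => nbb'.
have /forall_inP/(_ b' bS')/implyP/(_ nbb')/pred0P := Sdisj b bS.
move/(_ (e2 (lift ord0 (hit b)))); by rewrite /= hitP // e hitP.
Qed.
End LabelledParallelClasses.

Local Open Scope ring_scope.

(** * Parallel classes from difference families *)

Lemma uniq_map_inj (S T : eqType) (f : S -> T) (s : seq S) :
  uniq (map f s) -> {in s &, injective f}.
Proof.
move=> Us x y xs ys exy.
have Lx : (index x s < size s)%N by rewrite index_mem.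
have Ly : (index y s < size s)%N by rewrite index_mem.
rewrite -(nth_index x xs) -(nth_index x ys); congr nth; apply/eqP.
rewrite -(nth_uniq (f x) _ _ Us) ?size_map //.
by rewrite !(nth_map x) // !nth_index // exy.
Qed.

Lemma uniq_allpairs_inj (S T : eqType) (V : eqType) (f : S -> T -> V) s t :
  uniq [seq f a b | a <- s, b <- t] ->
  forall a a' b b', a \in s -> a' \in s -> b \in t -> b' \in t ->
  f a b = f a' b' -> a = a' /\ b = b'.
Proof.
have -> : [seq f a b | a <- s, b <- t] =
          map (fun p => f p.1 p.2) [seq (a, b) | a <- s, b <- t].
  by rewrite map_allpairs.
move=> /uniq_map_inj fI a a' b b' sa sa' tb tb' e.
by have [] : (a, b) = (a', b') by apply: fI => //; apply: allpairs_f.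
Qed.

Lemma uniq_cat_neq (T : eqType) (s t : seq T) x y :
  uniq (s ++ t) -> x \in s -> y \in t -> x != y.
Proof.
rewrite cat_uniq => /and3P[_ /hasPn st _] xs yt.
by apply/eqP => exy; move: (st _ yt); rewrite -exy xs.
Qed.

Section Triples.
Variable V : zmodType.
Implicit Types (c o : nat) (t : V * V * V) (P Q : seq (V * V * V)).

Definition component c t : V :=
  match c with 0 => t.1.1 | 1 => t.1.2 | _ => t.2 end.

(** The successor in Z_3, taken on naturals so that families over the integers unfold by
    computation. *)
Definition next_orbit o : nat := match o with 0 => 1 | 1 => 2 | _ => 0 end.

(** One list serves all three orbits: orbit o receives x and y from the triples with i = o and z
    from those with i + 1 = o, hence every component once. *)
Definition vertices P := [seq component c t | c <- [:: 0%N; 1%N; 2%N], t <- P].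

(* A triple (x, y, z) of P has x and y in the same orbit and z in the next. *)
Definition pure_diffs P :=
  [seq component c t - component (1 - c) t | c <- [:: 0%N; 1%N], t <- P].

Definition mixed_diffs P :=
  [seq component 2 t - component c t | c <- [:: 0%N; 1%N], t <- P].

Definition transversal_diffs o Q :=
  [seq component (next_orbit o) t - component o t | t <- Q].

(** The notion of distinctness is a parameter: [uniq] in a group, pairwise incongruence modulo n for
    integer representatives. *)
Definition all_diffs (distinct : pred (seq V)) P Q : bool :=
  distinct (pure_diffs P) &&
  all (fun o => distinct (vertices P ++ map (component o) Q) &&
                distinct (mixed_diffs P ++ transversal_diffs o Q)) (iota 0 3).

Definition difference_family := all_diffs uniq.
End Triples.

(** * Translates of the base class under the group *)

Section Development.
Variables (G : finZmodType) (P Q : seq (G * G * G)).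
Hypothesis famPQ : difference_family P Q.
Local Notation point := ('Z_3 * G)%type.
Local Notation base_index := (('Z_3 * (G * G * G)) + (G * G * G))%type.

Lemma difference_family_pure : uniq (pure_diffs P).
Proof. by case/andP: famPQ. Qed.

Lemma difference_family_vertices (o : 'Z_3) :
  uniq (vertices P ++ map (component o) Q).
Proof.
case/andP: famPQ => _ /allP/(_ (o : nat)); rewrite mem_iota /= ltn_ord => /(_ isT).
by case/andP.
Qed.

Lemma difference_family_mixed (o : 'Z_3) :
  uniq (mixed_diffs P ++ transversal_diffs o Q).
Proof.
case/andP: famPQ => _ /allP/(_ (o : nat)); rewrite mem_iota /= ltn_ord => /(_ isT).
by case/andP.
Qed.

Lemma next_orbitE (o : 'Z_3) : next_orbit o = (o + 1)%R :> nat.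
Proof. by case: o => [[|[|[|]]]]. Qed.

Definition base : seq base_index :=
  [seq inl (i, t) | i <- enum 'Z_3, t <- P] ++ map inr Q.

Definition block (k : base_index) (g : G) : {set point} :=
  match k with
  | inl (i, t) =>
      [set (i, component 0 t + g); (i, component 1 t + g); (i + 1, component 2 t + g)]
  | inr t => [set (o, component o t + g) | o : 'Z_3]
  end.

Lemma mem_base_inl i t : (inl (i, t) \in base) = (t \in P).
Proof.
rewrite mem_cat; apply/orP/idP => [[/allpairsP[[j u] /= [_ uP [_ ->]]] //|/mapP[//]]|tP].
by left; apply/allpairsP; exists (i, t); rewrite mem_enum.
Qed.

Lemma mem_base_inr t : (inr t \in base) = (t \in Q).
Proof.
rewrite mem_cat; apply/orP/idP => [[/allpairsP[[j u] /= []] //|/mapP[u uQ [->]] //]|tQ].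
by right; apply/mapP; exists t.
Qed.

Lemma Z3_succ_neq (i : 'Z_3) : i + 1 != i.
Proof. by case: i => [[|[|[|]]]]. Qed.

Lemma Z3_succ2_neq (i : 'Z_3) : i + 1 + 1 != i.
Proof. by case: i => [[|[|[|]]]]. Qed.

Lemma block_inlP i t g o a :
  (o, a) \in block (inl (i, t)) g ->
  (o = i /\ exists2 c, c \in [:: 0%N; 1%N] & a = component c t + g) \/
  (o = i + 1 /\ a = component 2 t + g).
Proof.
rewrite /block !inE => /orP[/orP[]|] /eqP[-> ->]; [left|left|by right].
  by split=> //; exists 0%N.
by split=> //; exists 1%N.
Qed.

Lemma block_inrP t g o a :
  (o, a) \in block (inr t) g -> a = component o t + g.
Proof. by case/imsetP => o' _ [-> ->]. Qed.

Lemma vertices_inj t t' c c' : t \in P -> t' \in P ->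
  c \in [:: 0%N; 1%N; 2%N] -> c' \in [:: 0%N; 1%N; 2%N] ->
  component c t = component c' t' -> c = c' /\ t = t'.
Proof.
move=> tP tP' cc cc'.
have := difference_family_vertices 0; rewrite cat_uniq => /andP[/uniq_allpairs_inj U _].
exact: U.
Qed.

Lemma vertices_neq t q o c : t \in P -> q \in Q ->
  c \in [:: 0%N; 1%N; 2%N] -> component c t <> component (o : 'Z_3) q.
Proof.
move=> tP qQ cc; apply/eqP; apply: (uniq_cat_neq (difference_family_vertices o)).
  by apply/allpairsP; exists (c, t).
exact: map_f.
Qed.

Lemma transversal_inj (o : 'Z_3) q q' : q \in Q -> q' \in Q ->
  component o q = component o q' -> q = q'.
Proof.
move=> qQ qQ'; have := difference_family_vertices o.
by rewrite cat_uniq => /and3P[_ _ /uniq_map_inj]; apply.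
Qed.

Lemma pure_diffs_inj t t' c c' : t \in P -> t' \in P ->
  c \in [:: 0%N; 1%N] -> c' \in [:: 0%N; 1%N] ->
  component c t - component (1 - c) t = component c' t' - component (1 - c') t' ->
  c = c' /\ t = t'.
Proof.
move=> tP tP' cc cc'.
exact: (uniq_allpairs_inj difference_family_pure).
Qed.

Lemma mixed_diffs_inj t t' c c' : t \in P -> t' \in P ->
  c \in [:: 0%N; 1%N] -> c' \in [:: 0%N; 1%N] ->
  component 2 t - component c t = component 2 t' - component c' t' -> c = c' /\ t = t'.
Proof.
move=> tP tP' cc cc'; have := difference_family_mixed 0.
rewrite cat_uniq => /andP[U _].
exact: (uniq_allpairs_inj U).
Qed.

Lemma mixed_diffs_neq t q (o : 'Z_3) c : t \in P -> q \in Q -> c \in [:: 0%N; 1%N] ->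
  component 2 t - component c t <> component (o + 1)%R q - component o q.
Proof.
move=> tP qQ cc; apply/eqP; apply: (uniq_cat_neq (difference_family_mixed o)).
  by apply/allpairsP; exists (c, t).
by rewrite -next_orbitE; apply: (map_f (fun t => component _ t - component _ t)).
Qed.

Lemma transversal_diffs_inj (o : 'Z_3) q q' : q \in Q -> q' \in Q ->
  component (o + 1)%R q - component o q = component (o + 1)%R q' - component o q' -> q = q'.
Proof.
move=> qQ qQ'; rewrite -next_orbitE; have := difference_family_mixed o.
by rewrite cat_uniq => /and3P[_ _ /uniq_map_inj]; apply.
Qed.

Lemma sub01_012 c : c \in [:: 0%N; 1%N] -> c \in [:: 0%N; 1%N; 2%N].
Proof. by rewrite !inE => /orP[] ->; rewrite ?orbT. Qed.

(** Subtracting [g] leaves a vertex of the base triple in the orbit of [p]. These vertices are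
    distinct, so they determine the triple and the component; the component tells whether the orbit
    is i or i + 1. *)
Lemma block_point_inj k k' g p : k \in base -> k' \in base ->
  p \in block k g -> p \in block k' g -> k = k'.
Proof.
case: p => o a; case: k => [[i t]|q]; case: k' => [[i' t']|q'];
  rewrite ?mem_base_inl ?mem_base_inr => hk hk'.
- move=> /block_inlP[[-> [c cc ->]]|[-> ->]] /block_inlP[[ei [c' cc' ev]]|[ei ev]];
    move: ev => /addIr ev.
  + by have [_ ->] := vertices_inj hk hk' (sub01_012 cc) (sub01_012 cc') ev; rewrite ei.
  + by have [ec] := @vertices_inj t t' c 2 hk hk' (sub01_012 cc) isT ev; move: cc; rewrite ec.
  + by have [ec] := @vertices_inj t t' 2 c' hk hk' isT (sub01_012 cc') ev; move: cc'; rewrite -ec.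
  + by have [_ ->] := @vertices_inj t t' 2 2 hk hk' isT isT ev; move/addIr: ei => ->.
- move=> /block_inlP[[_ [c cc ->]]|[_ ->]] /block_inrP/addIr.
  + by move/(vertices_neq hk hk' (sub01_012 cc)).
  + by move/(@vertices_neq t q' o 2 hk hk' isT).
- move=> /block_inrP-> /block_inlP[[_ [c cc]]|[_]] /addIr/esym.
  + by move/(vertices_neq hk' hk (sub01_012 cc)).
  + by move/(@vertices_neq t' q o 2 hk' hk isT).
- by move=> /block_inrP-> /block_inrP/addIr/(transversal_inj hk hk') ->.
Qed.

(** A triple of [Q] meets each orbit once, so the points come from the first two components of a
    triple of [P]; [c] tells which of them gives [a]. *)
Lemma block_same_orbit k g o a b : k \in base -> a != b ->
  (o, a) \in block k g -> (o, b) \in block k g ->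
  exists t c, [/\ k = inl (o, t), t \in P, c \in [:: 0%N; 1%N],
    a = component c t + g & b = component (1 - c) t + g].
Proof.
case: k => [[i t]|q]; rewrite ?mem_base_inl ?mem_base_inr => hk nab; last first.
  by move=> /block_inrP ea /block_inrP eb; rewrite ea eb eqxx in nab.
move=> /block_inlP[[-> [c cc ea]]|[-> ea]] /block_inlP[[ei [c' cc' eb]]|[ei eb]].
- exists t, c; split=> //; rewrite eb; congr (component _ _ + _).
  apply/eqP/negP => /negP ne; move: nab; rewrite ea eb.
  by move: cc cc' ne; rewrite !inE => /orP[]/eqP-> /orP[]/eqP->; rewrite ?eqxx.
- by case/eqP: (Z3_succ_neq i).
- by case/eqP: (Z3_succ_neq i).
- by rewrite ea eb eqxx in nab.
Qed.

(** A triple of [P] meets only the orbits i and i + 1, and i + 2 differs from i, so here o = i. *)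
Lemma block_next_orbit k g o a b : k \in base ->
  (o, a) \in block k g -> (o + 1, b) \in block k g ->
  (exists t c, [/\ k = inl (o, t), t \in P, c \in [:: 0%N; 1%N],
    a = component c t + g & b = component 2 t + g]) \/
  (exists q, [/\ k = inr q, q \in Q, a = component o q + g & b = component (o + 1)%R q + g]).
Proof.
case: k => [[i t]|q]; rewrite ?mem_base_inl ?mem_base_inr => hk; last first.
  by move=> /block_inrP ea /block_inrP eb; right; exists q.
move=> /block_inlP[[-> [c cc ea]]|[-> ea]] /block_inlP[[ei [c' cc' eb]]|[ei eb]].
- by case/eqP: (Z3_succ_neq i).
- by left; exists t, c.
- by case/eqP: (Z3_succ2_neq i).
- by move/addIr/eqP: ei; rewrite (negPf (Z3_succ_neq i)).
Qed.

Lemma subr_addr2 (a b g : G) : (a + g) - (b + g) = a - b.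
Proof. by rewrite opprD addrACA subrr addr0. Qed.

(** The difference of the two points is invariant under translation. As all differences are
    distinct, it determines the base triple and the place of the points in it; either point then
    gives [g]. *)
Lemma block_pair_inj_oriented k k' g g' o o' a b : k \in base -> k' \in base ->
  (o' == o) || (o' == o + 1) -> (o, a) != (o', b) ->
  (o, a) \in block k g -> (o', b) \in block k g ->
  (o, a) \in block k' g' -> (o', b) \in block k' g' -> k = k' /\ g = g'.
Proof.
move=> hk hk' /orP[]/eqP-> nab pk qk pk' qk'.
  have nab' : a != b by apply: contraNneq nab => ->.
  have [t [c [-> tP cc ea eb]]] := block_same_orbit hk nab' pk qk.
  have [t' [c' [-> tP' cc' ea' eb']]] := block_same_orbit hk' nab' pk' qk'.
  have [ec et] : c = c' /\ t = t'.
    apply: pure_diffs_inj => //.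
    by rewrite -(subr_addr2 (component c t) _ g) -ea -eb -(subr_addr2 (component c' t') _ g') -ea' -eb'.
  by subst c' t'; split=> //; move: ea'; rewrite ea => /addrI.
have [[t [c [-> tP cc ea eb]]]|[q [-> hq ea eb]]] := block_next_orbit hk pk qk;
have [[t' [c' [-> tP' cc' ea' eb']]]|[q' [-> hq' ea' eb']]] := block_next_orbit hk' pk' qk'.
- have [ec et] : c = c' /\ t = t'.
    apply: mixed_diffs_inj => //.
    by rewrite -(subr_addr2 (component 2 t) _ g) -ea -eb -(subr_addr2 (component 2 t') _ g') -ea' -eb'.
  by subst c' t'; split=> //; move: ea'; rewrite ea => /addrI.
- case: (@mixed_diffs_neq t q' o c) => //.
  by rewrite -(subr_addr2 (component 2 t) _ g) -ea -eb -(subr_addr2 (component (o + 1)%R q') _ g') -ea' -eb'.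
- case: (@mixed_diffs_neq t' q o c') => //.
  by rewrite -(subr_addr2 (component 2 t') _ g') -(subr_addr2 (component (o + 1)%R q) _ g) -ea -eb -ea' -eb'.
- have eq : q = q'.
    apply: (@transversal_diffs_inj o) => //.
    by rewrite -(subr_addr2 (component (o + 1)%R q) _ g) -ea -eb -(subr_addr2 (component (o + 1)%R q') _ g') -ea' -eb'.
  by subst q'; split=> //; move: ea'; rewrite ea => /addrI.
Qed.

(** Lets any two points be ordered as [block_pair_inj_oriented] asks. *)
Lemma Z3_cases (o o' : 'Z_3) :
  ((o' == o) || (o' == o + 1)) || ((o == o') || (o == o' + 1)).
Proof. by case: o o' => [[|[|[|]]]] // io [[|[|[|]]]]. Qed.

Lemma block_pair_inj k k' g g' p q : k \in base -> k' \in base -> p != q ->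
  p \in block k g -> q \in block k g -> p \in block k' g' -> q \in block k' g' ->
  k = k' /\ g = g'.
Proof.
case: p q => [o a] [o' b] hk hk' npq pk qk pk' qk'.
have /orP[oo|oo] := Z3_cases o o'.
  exact: (block_pair_inj_oriented hk hk' oo npq pk qk pk' qk').
rewrite eq_sym in npq.
exact: (block_pair_inj_oriented hk hk' oo npq qk pk qk' pk').
Qed.

Lemma card_block k g : k \in base -> #|block k g| = 3.
Proof.
case: k => [[i t]|q]; rewrite ?mem_base_inl ?mem_base_inr => hk.
  rewrite /block setUC cardsU1 !inE cards2 !xpair_eqE (negPf (Z3_succ_neq i)) /= eqxx.
  case: (eqVneq (component 0 t + g) _) => // /addIr.
  by case/(@vertices_inj t t 0 1 hk hk isT isT).
by rewrite card_imset ?card_ord // => o o' [].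
Qed.

Lemma uniq_base : uniq base.
Proof.
have := difference_family_vertices 0; rewrite cat_uniq => /and3P[UV _ UQ].
rewrite cat_uniq; apply/and3P; split.
- apply: allpairs_uniq; first exact: enum_uniq.
    by move: UV; rewrite cat_uniq => /andP[/map_uniq].
  by move=> [i t] [j u] _ _ [-> ->].
- by apply/hasPn => _ /mapP[q _ ->]; apply/allpairsP => -[[i t] []].
- by rewrite map_inj_uniq ?(map_uniq UQ) // => q q' [].
Qed.

Lemma size_base : size base = (3 * size P + size Q)%N.
Proof. by rewrite size_cat size_allpairs (size_map inr) size_enum_ord. Qed.

Definition parallel_class (g : G) : {set {set point}} := [set block k g | k in base].

Lemma parallel_class_card g : #|parallel_class g| = (3 * size P + size Q)%N.
Proof.
rewrite card_in_imset; first by rewrite (card_uniqP uniq_base) size_base.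
move=> k k' hk hk' e; have : (0 < #|block k g|)%N by rewrite card_block.
by case/card_gt0P => p pk; apply: (block_point_inj hk hk' pk); rewrite -e.
Qed.

Lemma parallel_class_card3 g B : B \in parallel_class g -> #|B| = 3.
Proof. by case/imsetP => k hk ->; apply: card_block. Qed.

Lemma parallel_class_point g B B' p : B \in parallel_class g -> B' \in parallel_class g ->
  p \in B -> p \in B' -> B = B'.
Proof.
case/imsetP => k hk -> /imsetP[k' hk' ->] pk pk'.
by rewrite (block_point_inj hk hk' pk pk').
Qed.

Lemma parallel_class_pair g g' B B' p q :
  B \in parallel_class g -> B' \in parallel_class g' -> p != q ->
  p \in B -> q \in B -> p \in B' -> q \in B' -> g = g'.
Proof.
case/imsetP => k hk -> /imsetP[k' hk' ->] npq pB qB pB' qB'.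
by case: (block_pair_inj hk hk' npq pB qB pB' qB').
Qed.

Lemma transversal_translates_disjoint t g g' :
  g != g' -> [disjoint block (inr t) g & block (inr t) g'].
Proof.
move=> ngg'; apply/pred0P => -[o a]; apply/negP => /andP[/block_inrP -> /block_inrP].
by move/addrI => egg'; rewrite egg' eqxx in ngg'.
Qed.

End Development.

(** * Explicit families over the integers modulo n *)

Definition incongruent (n : nat) : rel int := fun a b => ~~ (n %| a - b)%Z.

Lemma intr_Zp_eq n (a b : int) : (1 < n)%N ->
  a%:~R = b%:~R :> 'Z_n -> (n %| a - b)%Z.
Proof.
move=> n1 /eqP; rewrite -subr_eq0 -intrB => /eqP.
have natE k : k%:R = 0 :> 'Z_n -> (n %| k)%N.
  by move=> /(congr1 val); rewrite /= val_Zp_nat // => /eqP.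
rewrite /dvdz; case: (a - b) => k /=; first exact: natE.
by rewrite NegzE mulrNz => /eqP; rewrite oppr_eq0 => /eqP/natE.
Qed.

Lemma uniq_map_intr n (s : seq int) : (1 < n)%N ->
  pairwise (incongruent n) s -> uniq (map (fun a => a%:~R : 'Z_n) s).
Proof.
move=> n1 hs; rewrite uniq_pairwise pairwise_map.
apply: sub_pairwise hs => a b; rewrite /incongruent /=.
by apply: contraNneq => /(intr_Zp_eq n1).
Qed.

(** * Reduction of integer families modulo n *)

Definition map3 (U V : Type) (f : U -> V) (t : U * U * U) := (f t.1.1, f t.1.2, f t.2).

Section MapFamily.
Variables (U V : zmodType) (f : {additive U -> V}).

Lemma component_map3 c t : component c (map3 f t) = f (component c t).
Proof. by case: c => [|[|c]]. Qed.

Lemma map_vertices P : vertices (map (map3 f) P) = map f (vertices P).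
Proof.
rewrite /vertices map_allpairs allpairs_mapr; apply: eq_allpairs => c t.
exact: component_map3.
Qed.

Lemma map_pure_diffs P : pure_diffs (map (map3 f) P) = map f (pure_diffs P).
Proof.
rewrite /pure_diffs map_allpairs allpairs_mapr; apply: eq_allpairs => c t.
by rewrite raddfB !component_map3.
Qed.

Lemma map_mixed_diffs P : mixed_diffs (map (map3 f) P) = map f (mixed_diffs P).
Proof.
rewrite /mixed_diffs map_allpairs allpairs_mapr; apply: eq_allpairs => c t.
by rewrite raddfB !component_map3.
Qed.

Lemma map_components o Q : map (component o) (map (map3 f) Q) = map f (map (component o) Q).
Proof. by rewrite -!map_comp; apply: eq_map => t /=; rewrite component_map3. Qed.

Lemma map_transversal_diffs o Q :
  transversal_diffs o (map (map3 f) Q) = map f (transversal_diffs o Q).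
Proof.
by rewrite /transversal_diffs -!map_comp; apply: eq_map => t /=; rewrite raddfB !component_map3.
Qed.
End MapFamily.

Lemma difference_family_Zp n (P Q : seq (int * int * int)) : (1 < n)%N ->
  all_diffs (pairwise (incongruent n)) P Q ->
  difference_family (map (map3 (intr : int -> 'Z_n)) P) (map (map3 intr) Q).
Proof.
move=> n1 /andP[hP /allP hQ]; apply/andP; split.
  by rewrite (map_pure_diffs (intr : {additive int -> 'Z_n})) uniq_map_intr.
apply/allP => o /hQ/andP[hV hM].
rewrite (map_vertices (intr : {additive int -> 'Z_n})).
rewrite (map_components (intr : {additive int -> 'Z_n})).
rewrite (map_mixed_diffs (intr : {additive int -> 'Z_n})).
rewrite (map_transversal_diffs (intr : {additive int -> 'Z_n})).
by rewrite -!map_cat !uniq_map_intr.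
Qed.

(** * Incongruence by linear arithmetic *)

(** If |a - b| < 2n, only the multiples 0, n and -n have to be excluded. All five conditions are
    linear, hence within reach of [lia]. *)
Lemma incongruentP (n : nat) (a b : int) :
  [/\ a - b < n *+ 2, - (n%:Z *+ 2) < a - b, a <> b, a <> b + n & b <> a + n] -> incongruent n a b.
Proof.
case=> h1 h2 h3 h4 h5; apply/negP => /dvdzP[q hq].
have [q0|[q1|[q2|[q3|q4]]]] : q = 0 \/ q = 1 \/ q = -1 \/ 2 <= q \/ q <= -2 by lia.
all: nia.
Qed.

Lemma pairwise_iota (T : Type) (r : rel T) (f : nat -> T) m :
  (forall i j, (i < j < m)%N -> r (f i) (f j)) -> pairwise r (map f (iota 0 m)).
Proof.
move=> h; rewrite pairwise_map; apply: (@sub_in_pairwise _ [pred i | i < m]%N ltn).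
- by move=> i j _ hj ij; apply: h; apply/andP; split; [exact: ij|exact: hj].
- by apply/allP => i; rewrite mem_iota.
- by rewrite -(sorted_pairwise ltn_trans) iota_ltn_sorted.
Qed.

Lemma allrel_iota (T : Type) (r : rel T) (f g : nat -> T) m m' :
  (forall i j, (i < m)%N -> (j < m')%N -> r (f i) (g j)) ->
  allrel r (map f (iota 0 m)) (map g (iota 0 m')).
Proof.
move=> h; rewrite allrel_mapl allrel_mapr; apply/allrelP => i j.
by rewrite !mem_iota; apply: h.
Qed.

Lemma all_iota (T : Type) (p : pred T) (f : nat -> T) m :
  (forall i, (i < m)%N -> p (f i)) -> all p (map f (iota 0 m)).
Proof. by move=> h; rewrite all_map; apply/allP => i; rewrite mem_iota; apply: h. Qed.

(** Compares the pieces of a concatenation with themselves and each other; progressions of symbolic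
    length are replaced by their indices. *)
Ltac distinct_mod :=
  rewrite ?cats0 ?pairwise_cat ?allrel_catl ?allrel_catr /=;
  repeat (apply/andP; split); try exact: isT;
  first [ apply: pairwise_iota => i j /= ij
        | apply: allrel_iota => i j /= hi hj
        | apply: all_iota => i /= hi
        | idtac ];
  repeat (apply/andP; split); try exact: isT;
  apply: incongruentP; split; lia.

Ltac difference_family_arith :=
  rewrite /all_diffs /= ?andbT /vertices /pure_diffs /mixed_diffs /transversal_diffs /allpairs /=
    !map_cat -!map_comp;
  repeat (apply/andP; split); distinct_mod.

(* In each family the slopes -1, 2, 1 and the starting values let the two
   progressions cover the points with asymptotic density 1 and the differences
   with density at most 1.  The remaining triples, and the families for the
   orders 14 and 20 (6 m + 8 fails for m = 1, 2), come from a computer search. *)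
Definition progression (m : nat) (x y z : int) : seq (int * int * int) :=
  [seq (x - j%:Z, y + 2 * j%:Z, z + j%:Z) | j <- iota 0 m].

(** Here and in the next three families, two progressions of length m are joined by 1, 1, 2, 3
    further triples in P, with 1, 5, 3, 3 triples in Q; so 3 |P| + |Q| is the order. *)
Definition pure_6m4 (m : nat) : seq (int * int * int) :=
  progression m (6 * m%:Z + 1) (3 * m%:Z + 3) 0 ++
  progression m (3 * m%:Z - 1) (3 * m%:Z + 2) m ++
  [:: (3 * m%:Z + 1, 6 * m%:Z + 2, 6 * m%:Z + 3)].

Definition transversal_6m4 (m : nat) : seq (int * int * int) :=
  [:: (3 * m%:Z, 3 * m%:Z, 3 * m%:Z)].

Lemma all_diffs_6m4 m : all_diffs (pairwise (incongruent (6 * m + 4)))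
  (pure_6m4 m) (transversal_6m4 m).
Proof. rewrite /pure_6m4 /progression. difference_family_arith. Qed.

Definition pure_6m8 (m : nat) : seq (int * int * int) :=
  progression m (6 * m%:Z + 7) (3 * m%:Z + 1) 0 ++
  progression m (3 * m%:Z) (3 * m%:Z + 2) (m%:Z + 1) ++
  [:: (5 * m%:Z + 2, 5 * m%:Z + 6, m%:Z)].

(** Each coordinate takes the offsets 1, 3, 4, 5, 7 from 5m, the points left free by [pure_6m8]. *)
Definition transversal_6m8 (m : nat) : seq (int * int * int) :=
  [seq (5 * m%:Z + t.1.1, 5 * m%:Z + t.1.2, 5 * m%:Z + t.2) |
   t <- [:: (1, 3, 7); (3, 7, 5); (4, 4, 4); (5, 1, 3); (7, 5, 1)]].

Lemma all_diffs_6m8 m : (2 < m)%N -> all_diffs (pairwise (incongruent (6 * m + 8)))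
  (pure_6m8 m) (transversal_6m8 m).
Proof. move=> m2; rewrite /pure_6m8 /progression. difference_family_arith. Qed.

Definition pure_6m9 (m : nat) : seq (int * int * int) :=
  progression m (2 * m%:Z + 2) (2 * m%:Z + 4) 0 ++
  progression m (5 * m%:Z + 8) (2 * m%:Z + 7) (5 * m%:Z + 9) ++
  [:: (m%:Z, m%:Z + 1, 4 * m%:Z + 4); (m%:Z + 2, 4 * m%:Z + 8, 4 * m%:Z + 7)].

(** Cyclic shifts of a triple put the same three vertices in every orbit and give the same three
    differences from each orbit to the next. *)
Definition rotations (x y z : int) : seq (int * int * int) :=
  [:: (x, y, z); (z, x, y); (y, z, x)].

Definition transversal_6m9 (m : nat) : seq (int * int * int) :=
  rotations (2 * m%:Z + 3) (2 * m%:Z + 5) (4 * m%:Z + 6).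

Lemma all_diffs_6m9 m : all_diffs (pairwise (incongruent (6 * m + 9)))
  (pure_6m9 m) (transversal_6m9 m).
Proof. rewrite /pure_6m9 /progression. difference_family_arith. Qed.

Definition pure_6m12 (m : nat) : seq (int * int * int) :=
  progression m (6 * m%:Z + 11) (3 * m%:Z + 7) 0 ++
  progression m (3 * m%:Z + 2) (3 * m%:Z + 10) (m%:Z + 3) ++
  [:: (m%:Z, m%:Z + 1, 3 * m%:Z + 3); (3 * m%:Z + 5, 3 * m%:Z + 8, 5 * m%:Z + 9);
      (5 * m%:Z + 7, 5 * m%:Z + 11, 3 * m%:Z + 6)].

Definition transversal_6m12 (m : nat) : seq (int * int * int) :=
  rotations (m%:Z + 2) (5 * m%:Z + 10) (3 * m%:Z + 4).

Lemma all_diffs_6m12 m : all_diffs (pairwise (incongruent (6 * m + 12)))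
  (pure_6m12 m) (transversal_6m12 m).
Proof. rewrite /pure_6m12 /progression. difference_family_arith. Qed.

(** * Packings of each order *)

(** The size condition makes each class cover all 3n points; the translates of one triple of [Q]
    serve as the chosen triples. *)
Lemma packing_of_difference_family (G : finZmodType) (P Q : seq (G * G * G)) (n rho : nat) :
  difference_family P Q -> #|G| = n -> (3 * size P + size Q)%N = n ->
  (0 < size Q)%N -> (0 < rho <= n)%N -> packing_exists n rho.
Proof.
move=> fam cardG sizePQ Q_gt0 /andP[rho_gt0 rho_n].
have [t tQ] : exists t, t \in Q by case: Q Q_gt0 {fam sizePQ} => // t Q _; exists t; rewrite mem_head.
apply: (@packing_of_parallel_classes _ _ _ _ (parallel_class P Q) (block (inr t)) _ cardG)
  => // [|y|y B|y B B' p|y y' B B' p q|y|y y'].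
- by rewrite card_prod card_ord cardG.
- by rewrite parallel_class_card.
- exact: parallel_class_card3.
- exact: parallel_class_point.
- exact: parallel_class_pair.
- by apply: imset_f; rewrite mem_base_inr.
- exact: transversal_translates_disjoint.
Qed.

(** The coordinates are x times 1, a, a^2, and the differences are x times a - 1, a(a - 1), -(a -
    1)(a + 1). All factors are units, so no value repeats. *)
Lemma multiplicative_family (R : finComUnitRingType) (a : R) :
  a \is a GRing.unit -> a - 1 \is a GRing.unit -> a + 1 \is a GRing.unit ->
  difference_family [::] [seq (x, a * x, a ^+ 2 * x) | x <- enum R].
Proof.
move=> ua ub uc.
move: (enum R) (enum_uniq R) => s s_uniq.
have uniq_mul (c : R) f : c \is a GRing.unit -> f =1 *%R c -> uniq (map f s).
  by move=> hc /eq_map ->; rewrite map_inj_uniq //; apply: mulrI.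
apply/andP; split=> //=; rewrite /transversal_diffs -!map_comp andbT.
apply/and3P; split; apply/andP; split.
- by apply: (uniq_mul 1) => [|x]; rewrite ?unitr1 //= mul1r.
- by apply: (uniq_mul (a - 1)) => // x /=; rewrite mulrBl mul1r.
- exact: (uniq_mul a).
- apply: (uniq_mul (a * (a - 1))) => [|x /=]; first by rewrite unitrM ua.
  by rewrite mulrBr mulr1 mulrBl expr2.
- by apply: (uniq_mul (a ^+ 2)); rewrite ?unitrX.
- apply: (uniq_mul (- ((a - 1) * (a + 1)))) => [|x /=].
    by rewrite unitrN unitrM ub.
  by rewrite -subr_sqr expr1n opprB mulrBl mul1r.
Qed.

Lemma packing_multiplicative (R : finComUnitRingType) (a : R) n rho :
  a \is a GRing.unit -> a - 1 \is a GRing.unit -> a + 1 \is a GRing.unit ->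
  #|R| = n -> (0 < rho <= n)%N -> packing_exists n rho.
Proof.
move=> ua ub uc cardR hrho.
apply: (packing_of_difference_family (multiplicative_family ua ub uc)) hrho => //=.
  by rewrite size_map -cardE.
by rewrite size_map -cardE; apply/card_gt0P; exists a.
Qed.

Lemma card_Zmod n : (1 < n)%N -> #|'Z_n| = n.
Proof. by move=> n1; rewrite card_ord Zp_cast. Qed.

Lemma packing_coprime6 n rho : (1 < n)%N -> coprime n 6 ->
  (0 < rho <= n)%N -> packing_exists n rho.
Proof.
move=> n1 n6; have [n2 n3] : coprime n 2 /\ coprime n 3.
  by apply/andP; rewrite -coprimeMr.
apply: (@packing_multiplicative 'Z_n 2%:R) (card_Zmod n1).
- by rewrite unitZpE.
- by rewrite mulr2n addrK unitr1.
- by rewrite natr1 unitZpE.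
Qed.

Lemma packing_order8 rho : (0 < rho <= 8)%N -> packing_exists 8 rho.
Proof.
have [F _ cardF] := PrimePowerField (isT : prime 2) (isT : 0 < 3)%N.
(* Excluding 0, 1 and -1 removes at most three of the eight elements; for any other a in a field, a,
   a - 1 and a + 1 are units. *)
have [a] : exists a, a \in ~: [set 0; 1; -1 : F].
  apply/card_gt0P; rewrite cardsCs setCK cardF subn_gt0.
  apply: leq_ltn_trans (leq_card_setU _ _) _.
  by rewrite cards1 cards2; case: (_ != _).
rewrite !inE !negb_or => /andP[/andP[a0 a1] a2].
apply: (@packing_multiplicative F a) cardF; rewrite unitfE //.
- by rewrite subr_eq0.
- by rewrite addr_eq0.
Qed.

Lemma packing_Zp n (P Q : seq (int * int * int)) rho :
  all_diffs (pairwise (incongruent n)) P Q -> (1 < n)%N ->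
  (3 * size P + size Q)%N = n -> (0 < size Q)%N -> (0 < rho <= n)%N -> packing_exists n rho.
Proof.
move=> hPQ n1 sizePQ Q_gt0; apply: (packing_of_difference_family (difference_family_Zp n1 hPQ)).
- exact: card_Zmod.
- by rewrite !size_map.
- by rewrite size_map.
Qed.

Definition pure_14 : seq (int * int * int) := [:: (7, 13, 0); (5, 4, 2); (1, 3, 9)].
Definition transversal_14 : seq (int * int * int) :=
  [:: (10, 10, 6); (8, 12, 12); (11, 6, 8); (6, 8, 11); (12, 11, 10)].
Definition pure_20 : seq (int * int * int) :=
  [:: (3, 16, 13); (6, 15, 10); (17, 12, 8); (1, 0, 2); (11, 9, 14)].
Definition transversal_20 : seq (int * int * int) :=
  [:: (18, 5, 19); (19, 7, 5); (5, 18, 7); (7, 19, 18); (4, 4, 4)].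

Lemma all_diffs_14 : all_diffs (pairwise (incongruent 14)) pure_14 transversal_14.
Proof. by vm_compute. Qed.
Lemma all_diffs_20 : all_diffs (pairwise (incongruent 20)) pure_20 transversal_20.
Proof. by vm_compute. Qed.

Lemma size_progression m x y z : size (progression m x y z) = m.
Proof. by rewrite size_map size_iota. Qed.

(* Case distinction on n modulo 6 *)
Local Close Scope ring_scope.

Theorem theorem2p9 (n rho : nat) :
  4 <= n -> n != 6 -> 1 <= rho <= n ->
  exists B : {set {set 'I_(3 * n + 1 + rho)}},
    is_packing 4 B /\
    #|B| = n * rho + D rho.+1 4 /\
    largest_ppc_size B rho.
Proof.
move=> n4 n6 hrho; change (packing_exists n rho).
have [n_cop|n_ncop] := boolP (coprime n 6).
  by apply: packing_coprime6; rewrite // (leq_trans _ n4).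
have [e8|[e14|[e20|[m n_m]]]] : n = 8 \/ n = 14 \/ n = 20 \/ exists m,
    [\/ n = 6 * m + 4, n = 6 * m + 8 /\ 2 < m, n = 6 * m + 9 | n = 6 * m + 12].
  have : [|| n %% 6 == 0, n %% 6 == 2, n %% 6 == 3 | n %% 6 == 4].
    move: n_ncop; rewrite -coprime_modl.
    have : (n %% 6 < 6) by rewrite ltn_mod.
    by case: (n %% 6) => [|[|[|[|[|[|]]]]]] //; vm_compute.
  (* Residue 0 forces n >= 12, since n is neither 0 nor 6, and residue 3 forces n >= 9. For residue
     2 the orders up to 20 are 8, 14 and 20; beyond them n >= 26, so m = n / 6 - 1 is at least 3. *)
  case/or4P => /eqP r; [do 3 right|have [?|n20] := leqP n 20|do 3 right|do 3 right].
  - by exists (n %/ 6 - 2); constructor 4; lia.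
  - by lia.
  - by do 3 right; exists (n %/ 6 - 1); constructor 2; lia.
  - by exists (n %/ 6 - 1); constructor 3; lia.
  - by exists (n %/ 6); constructor 1; lia.
- by move: hrho; rewrite e8; apply: packing_order8.
- by move: hrho; rewrite e14; apply: packing_Zp all_diffs_14 _ _ _.
- by move: hrho; rewrite e20; apply: packing_Zp all_diffs_20 _ _ _.
move: hrho; case: n_m => [->|[-> m2]|->|->];
  [apply: packing_Zp (all_diffs_6m4 m) _ _ _ | apply: packing_Zp (all_diffs_6m8 m2) _ _ _
  |apply: packing_Zp (all_diffs_6m9 m) _ _ _ | apply: packing_Zp (all_diffs_6m12 m) _ _ _];
  rewrite // ?size_cat ?size_progression /=; lia.
Qed.
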